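(* Let $X$ be an $n$-dimensional Euclidean or Hermitian space with a fixed orthonormal basis $(v_1,\ldots,v_n)$, with associated creation operators $a_{\mathbf{r}}^\dagger$ and annihilation operators $a_{\mathbf{r}}$. For all $\mathbf{i},\mathbf{j}\in\mathcal{I}^n$ we have $\llbracket a_{\mathbf{i}},a_{\mathbf{j}}\rrbracket=\llbracket a_{\mathbf{i}}^\dagger,a_{\mathbf{j}}^\dagger\rrbracket=0$, $$\llbracket a_{\mathbf{i}}^\dagger,a_{\mathbf{j}}\rrbracket=\sum_{\emptyset\neq\mathbf{l}\subset\mathbf{i}\cap\mathbf{j}}(-1)^{1+|\mathbf{l}|+|\mathbf{i}\triangle\mathbf{j}>\mathbf{l}|}\; a_{\mathbf{i}\backslash\mathbf{l}}^\dagger\,a_{\mathbf{j}\backslash\mathbf{l}},$$ and $$\llbracket a_{\mathbf{i}},a_{\mathbf{j}}^\dagger\rrbracket=\sum_{\emptyset\neq\mathbf{l}\subset\mathbf{i}\cap\mathbf{j}}(-1)^{1+|\mathbf{l}|+|\mathbf{l}>\mathbf{i}\triangle\mathbf{j}|}\; a_{\mathbf{i}\backslash\mathbf{l}}\,a_{\mathbf{j}\backslash\mathbf{l}}^\dagger .$$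
   Context: $X$ is a Euclidean (real inner product) or Hermitian (complex inner product) space of dimension $n$, with product $\langle\cdot,\cdot\rangle$ (conjugate-linear in the first argument in the complex case). $\bigwedge X$ is its exterior algebra with the induced inner product (different grades orthogonal, $\langle x_1\wedge\cdots\wedge x_p,y_1\wedge\cdots\wedge y_p\rangle=\det(\langle x_i,y_j\rangle)$). The left contraction $M\lrcorner N$ is defined by $\langle L,M\lrcorner N\rangle=\langle M\wedge L,N\rangle$ for all $L\in\bigwedge X$. Multi-indices: $\mathcal{I}^n$ is the set of all increasing multi-indices $(i_1,\ldots,i_p)$, $1\le i_1<\cdots<i_p\le n$, $0\le p\le n$ (including $\emptyset$), identified with subsets of $\{1,\ldots,n\}$; $|\mathbf{i}|$ is the number of indices; $\cap$, $\backslash$, $\triangle$ are intersection, difference and symmetric difference, in increasing order. $v_{\mathbf{i}}=v_{i_1}\wedge\cdots\wedge v_{i_p}$, $v_\emptyset=1$. $|\mathbf{r}>\mathbf{s}|$ is the number of pairs $(i,j)$ with $i\in\mathbf{r}$, $j\in\mathbf{s}$, $i>j$. Operators on $\bigwedge X$: $a_{\mathbf{r}}^\dagger(N)=v_{\mathbf{r}}\wedge N$ and $a_{\mathbf{r}}(N)=v_{\mathbf{r}}\lrcorner N$. Supercommutator: $\bigwedge X$ is $\mathbb{Z}_2$-graded by even and odd grades, and $\mathrm{End}(\bigwedge X)$ is a superalgebra, an endomorphism being even (parity 0) if it preserves and odd (parity 1) if it switches parity of multivectors. $\llbracket S,T\rrbracket=ST-(-1)^{st}TS$ for $S,T$ of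 parities $s,t$ (extended bilinearly). The operators $a_{\mathbf{r}}$ and $a_{\mathbf{r}}^\dagger$ have the parity of $|\mathbf{r}|$. *)

(* Defs.v *)
From HB Require Import structures.
From mathcomp Require Import all_boot all_order all_algebra all_field.
From mathcomp Require Import sesquilinear.
From mathcomp Require Import reals complex.

Set Implicit Arguments.
Unset Strict Implicit.
Unset Printing Implicit Defensive.

Import GRing.Theory Num.Theory.

Local Open Scope ring_scope.
Local Open Scope complex_scope.

Variant geometry := EuclideanSpace | HermitianSpace.

Definition scalars (R : realType) (g : geometry) : numFieldType :=
  match g with
  | EuclideanSpace => R
  | HermitianSpace => R[i]
  end.

Definition conj_scalars (R : realType) (g : geometry) :
    {rmorphism scalars R g -> scalars R g} :=
  match g with
  | EuclideanSpace => idfun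
  | HermitianSpace => Num.conj
  end.

(* [{dot U for theta}] is linear in its first argument and theta-semilinear
   in the second; [inner] is conjugate-linear in the first argument. *)
Definition inner (K : numFieldType) (theta : {rmorphism K -> K})
    (U : lmodType K) (dot : {dot U for theta}) (x y : U) : K := dot y x.

Section Exterior.
Variables (K : numFieldType) (X : vectType K) (E : falgType K).
Variable emb : 'Hom(X, E).

Definition square_zero (A : algType K) (f : X -> A) : Prop :=
  forall x, f x * f x = 0.

(* Universal property of [X -> E], the product of [E] being the wedge. *)
Definition is_exterior_algebra : Prop :=
  square_zero emb /\
  forall (A : algType K) (f : {linear X -> A}), square_zero f ->
    exists2 h : {lrmorphism E -> A},
      (forall x, h (emb x) = f x) &
      (forall h' : {lrmorphism E -> A},
         (forall x, h' (emb x) = f x) -> h' =1 h).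

Definition grade (p : nat) : {vspace E} := (limg emb ^+ p)%VS.

(* Multivectors of parity [b]: [false] is even, [true] is odd. *)
Definition parity_space (b : bool) : {vspace E} :=
  (\sum_(p < (\dim {:X}).+1 | odd p == b) grade p)%VS.

Section InducedProduct.
Variables (theta : {rmorphism K -> K}).
Variables (dotX : {dot X for theta}) (dotE : {dot E for theta}).

Definition is_induced_product : Prop :=
  (forall p q (M N : E), p != q -> M \in grade p -> N \in grade q ->
     inner dotE M N = 0) /\
  (forall p (x y : 'I_p -> X),
     inner dotE (\prod_(i < p) emb (x i)) (\prod_(i < p) emb (y i)) =
     \det (\matrix_(i, j) inner dotX (x i) (y j))).

Definition is_left_contraction (lcontr : E -> E -> E) : Prop :=
  forall L M N : E, inner dotE L (lcontr M N) = inner dotE (M * L) N.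

End InducedProduct.

(* The projection onto the multivectors of parity [b] along the others. *)
Definition parity_proj (b : bool) : 'End(E) :=
  daddv_pi (parity_space b) (parity_space (~~ b)).

(* The parity-[s] component of an endomorphism. *)
Definition parity_part (s : bool) (S : 'End(E)) : 'End(E) :=
  \sum_(t : bool) (parity_proj (s (+) t) \o S \o parity_proj t)%VF.

(* The bilinear extension of ST - (-1)^{st} TS from homogeneous S, T. *)
Definition supercomm (S T : 'End(E)) : 'End(E) :=
  \sum_(s : bool) \sum_(t : bool)
    ((parity_part s S \o parity_part t T)%VF
     - (-1) ^+ (s * t)%N *: (parity_part t T \o parity_part s S)%VF).

Definition has_parity (s : bool) (S : 'End(E)) : Prop :=
  forall t, (S @: parity_space t <= parity_space (s (+) t))%VS.

Lemma supercommE (s t : bool) (S T : 'End(E)) :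
    (parity_space false + parity_space true = fullv)%VS ->
    (parity_space false :&: parity_space true = 0)%VS ->
    has_parity s S -> has_parity t T ->
  supercomm S T = (S \o T)%VF - (-1) ^+ (s * t)%N *: (T \o S)%VF.
Proof.
move=> sumE capE hS hT.
have cap b : (parity_space b :&: parity_space (~~ b) = 0)%VS.
  by case: b; rewrite //= capvC.
have in_proj b w : parity_proj b w \in parity_space b by exact: memv_pi.
have id_proj b w : w \in parity_space b -> parity_proj b w = w.
  exact: daddv_pi_id.
have proj0 b w : w \in parity_space b -> parity_proj (~~ b) w = 0.
  move=> wb; have fw : w \in (parity_space b + parity_space (~~ b))%VS.
    by case: b {wb} => /=; first rewrite addvC; rewrite sumE memvf.
  have := daddv_pi_add (cap b) fw.
  rewrite [daddv_pi (parity_space b) _ w]daddv_pi_id // => /(canRL (addKr _)).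
  by rewrite addNr /parity_proj negbK.
have sum_proj w : parity_proj true w + parity_proj false w = w.
  by apply: daddv_pi_add; [exact: cap | rewrite addvC sumE memvf].
have part u (P : 'End(E)) : has_parity u P ->
    parity_part u P = P /\ parity_part (~~ u) P = 0.
  move=> hP; have hPw b w : P (parity_proj b w) \in parity_space (u (+) b).
    by apply: (subvP (hP b)); rewrite memv_img.
  split; apply/lfunP=> w; rewrite /parity_part big_bool add_lfunE !comp_lfunE.
    rewrite (id_proj _ _ (hPw true w)) (id_proj _ _ (hPw false w)).
    by rewrite -(linearD P) sum_proj.
  rewrite !addNb (proj0 _ _ (hPw true w)) (proj0 _ _ (hPw false w)).
  by rewrite addr0 zero_lfunE.
have [S1 S0] := part _ _ hS; have [T1 T0] := part _ _ hT.
rewrite /supercomm !big_bool.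
case: s S1 S0 {hS} => /= S1 S0; case: t T1 T0 {hT} => /= T1 T0;
by rewrite S1 S0 T1 T0
     !(comp_lfun0l, comp_lfun0r, scaler0, subr0, oppr0, addr0, add0r).
Qed.

End Exterior.

Section MultiIndices.
Variable n : nat.

(* Increasing multi-indices are the subsets of 'I_n. *)
Definition symdiff (r s : {set 'I_n}) : {set 'I_n} := (r :\: s) :|: (s :\: r).

Definition inversions (r s : {set 'I_n}) : nat :=
  #|[set ij : 'I_n * 'I_n | [&& ij.1 \in r, ij.2 \in s & ij.2 < ij.1]%N]|.

Variables (K : numFieldType) (X : vectType K) (E : falgType K).
Variables (emb : 'Hom(X, E)) (v : n.-tuple X).

(* [\prod_(k in r)] multiplies in increasing order of [k]. *)
Definition blade (r : {set 'I_n}) : E := \prod_(k in r) emb (tnth v k).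

Definition creation (r : {set 'I_n}) : 'End(E) :=
  linfun (fun N : E => blade r * N).

(* A left contraction is linear in its second argument, [dotE] being
   nondegenerate, so [linfun] returns the contraction by [blade r]. *)
Definition annihilation (lcontr : E -> E -> E) (r : {set 'I_n}) : 'End(E) :=
  linfun (fun N : E => lcontr (blade r) N).

End MultiIndices.

(* Main.v *)
(* The creation operators c_k = a_k^dagger and annihilation operators d_k = a_k
   satisfy the canonical anticommutation relations; a_r^dagger is the increasing
   product of the c_k and a_r, being its adjoint, the decreasing product of the
   d_k.  Peeling off the largest index turns the normal ordering of
   a_j a_i^dagger into an induction (Wick's theorem).  The relations are
   unchanged when c and d are exchanged and the order of the indices is
   reversed, so the same induction also gives the last formula.

   The product of [FalgLfun] is f * g = g \o f, so in that ring a_r is the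
   increasing product and a_r^dagger the decreasing one. *)
Require Import Defs.
From HB Require Import structures.
From mathcomp Require Import all_boot all_order all_algebra all_field.
From mathcomp Require Import sesquilinear.
From mathcomp Require Import reals complex.

Set Implicit Arguments.
Unset Strict Implicit.
Unset Printing Implicit Defensive.

Import Order.TTheory GRing.Theory Num.Theory.

Local Open Scope ring_scope.

(** * Wick's theorem *)

(** Subsets containing [k] are reindexed by deleting [k]. In the Wick induction the two summands are
    the terms in which the last index stays uncontracted and contracted. *)
Lemma big_subsetU1 (V : nmodType) (I : finType) (k : I) (A : {set I})
    (F : {set I} -> V) : k \notin A ->
  \sum_(l : {set I} | l \subset k |: A) F l =
  \sum_(l : {set I} | l \subset A) (F l + F (k |: l)).
Proof.
move=> kA; rewrite big_split /= (bigID (fun l : {set I} => k \in l)) /= addrC.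
congr (_ + _).
  by apply: eq_bigl => l; rewrite -{2}(setU1K kA) subsetD1.
rewrite (reindex_onto (fun l => k |: l) (fun l => l :\ k)) /=; last first.
  by move=> l /andP[_ kl]; rewrite setD1K.
apply: eq_bigl => l; rewrite setU11 andbT.
apply/andP/idP => [[sl /eqP <-]|sl].
  by rewrite -(setU1K kA) setSD.
by rewrite setUS // setU1K //; apply: contra kA; apply/subsetP.
Qed.

(** The order is a parameter so that one induction serves both formulas: [<] gives $|r>l|$ and [>]
    gives $|l>r|$. *)
Definition inv_sum (I : finType) (e : rel I) (r l : {set I}) : nat :=
  (\sum_(x in r) \sum_(y in l) e y x)%N.

Lemma inversions_ltE n (r l : {set 'I_n}) :
  inversions r l = inv_sum (fun x y : 'I_n => x < y)%N r l.
Proof.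
rewrite /inversions /inv_sum -sum1_card pair_big_dep /= big_mkcond /=.
rewrite [RHS]big_mkcond; apply: eq_bigr => -[x y] _; rewrite inE /=.
by case: (x \in r); case: (y \in l); case: (y < x)%N.
Qed.

Lemma inversions_gtE n (r l : {set 'I_n}) :
  inversions r l = inv_sum (fun x y : 'I_n => y < x)%N l r.
Proof. by rewrite inversions_ltE /inv_sum exchange_big. Qed.

Lemma symdiffC n (r l : {set 'I_n}) : symdiff r l = symdiff l r.
Proof. exact: setUC. Qed.

Lemma count_mem_set (I : finType) (s : seq I) (B : {set I}) :
  uniq s -> {subset B <= s} -> count (mem B) s = #|B|.
Proof.
move=> us sB; rewrite -size_filter -(card_uniqP _) ?filter_uniq //.
by apply: eq_card => x; rewrite mem_filter; apply/andP/idP => [[]//|xB]; split=> //; apply: sB.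
Qed.

(** * Products over a set, ordered by a sequence *)

Section OrderedProducts.
Variables (K : comNzRingType) (A : algType K).

Lemma sign_comm_prod (J : Type) (s : seq J) (P : pred J) (f : J -> A)
    (x : A) (m : nat) :
  (forall k, P k -> x * f k = (-1) ^+ m *: (f k * x)) ->
  x * \prod_(k <- s | P k) f k =
  (-1) ^+ (m * count P s)%N *: (\prod_(k <- s | P k) f k * x).
Proof.
move=> xf; elim: s => [|k s IHs]; first by rewrite !big_nil /= muln0 scale1r mulr1 mul1r.
rewrite !big_cons /=; case: ifP => // Pk.
by rewrite mulrA xf // -scalerAl -[_ * x * _]mulrA IHs -scalerAr scalerA mulrA mulnS exprD.
Qed.

Variable I : finType.

(** The sequence fixes the order of the factors and the set selects them, so the order can be
    reversed, or shortened in an induction, independently of the set. *)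
Definition oprod (s : seq I) (f : I -> A) (B : {set I}) : A :=
  \prod_(k <- s | k \in B) f k.

Lemma oprod_rconsU1 s k f (B : {set I}) : k \notin s ->
  oprod (rcons s k) f (k |: B) = oprod s f B * f k.
Proof.
move=> ks; rewrite /oprod big_rcons /= setU11.
congr (_ * _); rewrite big_seq_cond [RHS]big_seq_cond; apply: eq_bigl => x.
rewrite in_setU1; case: eqP => // ->; by rewrite (negPf ks).
Qed.

Lemma oprod_rcons_notin s k f (B : {set I}) : k \notin B ->
  oprod (rcons s k) f B = oprod s f B.
Proof. by move=> kB; rewrite /oprod big_rcons /= (negPf kB) mulr1. Qed.

Lemma oprod_consU1 s k f (B : {set I}) : k \notin s ->
  oprod (k :: s) f (k |: B) = f k * oprod s f B.
Proof.
move=> ks; rewrite /oprod big_cons setU11.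
congr (_ * _); rewrite big_seq_cond [RHS]big_seq_cond; apply: eq_bigl => x.
rewrite in_setU1; case: eqP => // ->; by rewrite (negPf ks).
Qed.

Lemma oprod_cons_notin s k f (B : {set I}) : k \notin B ->
  oprod (k :: s) f B = oprod s f B.
Proof. by move=> kB; rewrite /oprod big_cons (negPf kB). Qed.

End OrderedProducts.

Lemma sum_subset_neq0 (V : zmodType) (I : finType) (A : {set I}) (F : {set I} -> V) :
  \sum_(l : {set I} | l \subset A) F l =
  F set0 + \sum_(l : {set I} | (l != set0) && (l \subset A)) F l.
Proof.
rewrite (bigD1 set0) ?sub0set //; congr (_ + _).
by apply: eq_bigl => l; rewrite andbC.
Qed.

Lemma inv_sum0r (I : finType) (e : rel I) (r : {set I}) : inv_sum e r set0 = 0%N.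
Proof. by rewrite /inv_sum big1 // => x _; rewrite big_set0. Qed.

Lemma inv_sumU1l (I : finType) (e : rel I) (k : I) (r l : {set I}) :
  k \notin r -> (forall y, y \in l -> e y k) ->
  inv_sum e (k |: r) l = (inv_sum e r l + #|l|)%N.
Proof.
move=> kr ek; rewrite /inv_sum big_setU1 //= addnC -sum1_card; congr addn.
by apply: eq_bigr => y /ek ->.
Qed.

Lemma inv_sumU1r (I : finType) (e : rel I) (k : I) (r l : {set I}) :
  k \notin l -> (forall x, x \in r -> ~~ e k x) ->
  inv_sum e r (k |: l) = inv_sum e r l.
Proof.
move=> kl ek; apply: eq_bigr => x /ek nx.
by rewrite big_setU1 //= (negPf nx).
Qed.

(** * Normal ordering in an algebra with the mixed anticommutation relations *)

Section Wick.
Variables (K : comNzRingType) (A : algType K) (n : nat).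
Variables (c d : 'I_n -> A).
Hypothesis cdN : forall x y, x != y -> d y * c x = - (c x * d y).
Hypothesis cd1 : forall x, d x * c x = 1 - c x * d x.
Variable e : rel 'I_n.
Hypothesis e_asym : forall x y, e x y -> ~~ e y x.

Notation P s := (oprod s c).
Notation Q s := (oprod (rev s) d).
Notation eps m := ((-1) ^+ m%N).

Let eps_eq m p : odd m = odd p -> eps m = eps p :> K.
Proof. by move=> mp; rewrite -signr_odd mp signr_odd. Qed.

Let epsN m : - eps m = eps m.+1 :> K.
Proof. by rewrite exprS mulN1r. Qed.

Let comm_set (x : A) (f : 'I_n -> A) (s : seq 'I_n) (B : {set 'I_n}) :
  uniq s -> {subset B <= s} -> (forall k, k \in B -> x * f k = - (f k * x)) ->
  x * oprod s f B = eps #|B| *: (oprod s f B * x).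
Proof.
move=> us Bs xf; rewrite -(count_mem_set us Bs) -[count _ _]mul1n.
by apply: sign_comm_prod => k kB; rewrite expr1 scaleN1r xf.
Qed.

(** The last index [k] of [s] supplies the outermost factors of [Q s j * P s i]: [d k] is leftmost
    and [c k] rightmost. In each term of the inductive expansion, [d k] moves right past the [c]
    factors and [c k] moves left past the [d] factors, until they stand in normal order or meet. The
    sign on the left gives the uncontracted term [l = set0] coefficient one. *)
Theorem wick (s : seq 'I_n) (i j : {set 'I_n}) :
  uniq s -> pairwise e s -> {subset i <= s} -> {subset j <= s} ->
  eps (#|i| * #|j|) *: (Q s j * P s i) =
  \sum_(l : {set 'I_n} | l \subset i :&: j)
    eps (#|l| + inv_sum e (symdiff i j) l) *: (P s (i :\: l) * Q s (j :\: l)).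
Proof.
elim/last_ind: s i j => [|s k IHs] i j.
  move=> _ _ i0 j0.
  have -> : i = set0 by apply/setP => x; rewrite inE; apply/negP => /i0.
  have -> : j = set0 by apply/setP => x; rewrite inE; apply/negP => /j0.
  rewrite (big_pred1 set0) => [|l]; last by rewrite setI0 subset0.
  rewrite /symdiff !setD0 setU0 /inv_sum big_set0 cards0 /=.
  by rewrite /oprod !big_nil.
rewrite rcons_uniq pairwise_rcons => /andP[ks us] /andP[/allP ek es] si sj.
(* Separating [k] from [i] and [j] leaves sets inside [s], to which the induction hypothesis
   applies; the four cases record which of the two contain [k]. *)
have split_set (B : {set 'I_n}) : {subset B <= rcons s k} ->
    exists B0 : {set 'I_n}, [/\ k \notin B0, {subset B0 <= s} &
      B = if k \in B then k |: B0 else B0].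
  move=> sB; exists (B :\ k); split; first by rewrite !inE eqxx.
    by move=> x /setD1P[xk /sB]; rewrite mem_rcons inE (negPf xk).
  by case: ifP => kB; [rewrite setD1K | apply/esym/setDidPl; rewrite disjoint_sym disjoints1 kB].
have [i0 [ki0 si0 ->]] := split_set i si.
have [j0 [kj0 sj0 ->]] := split_set j sj.
have {IHs} IH := IHs i0 j0 us es si0 sj0.
have urs : uniq (rev s) by rewrite rev_uniq.
have krs : k \notin rev s by rewrite mem_rev.
have subl (l : {set 'I_n}) : l \subset i0 :&: j0 ->
    [/\ l \subset i0, l \subset j0, k \notin l & forall y, y \in l -> e y k].
  move=> sl; have /andP[li lj] : (l \subset i0) && (l \subset j0).
    by rewrite -subsetI.
  split=> //; first by apply: contra ki0; apply/subsetP.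
  by move=> y /(subsetP li)/si0/ek.
have kD (B l : {set 'I_n}) : k \notin B -> k \notin B :\: l.
  by rewrite in_setD negb_and orbC => ->.
have sD (B l : {set 'I_n}) : {subset B <= s} -> {subset B :\: l <= s}.
  by move=> sB x /setDP[/sB].
have sDr (B l : {set 'I_n}) : {subset B <= s} -> {subset B :\: l <= rev s}.
  by move=> sB x /setDP[/sB]; rewrite mem_rev.
have neqk (B : {set 'I_n}) x : k \notin B -> x \in B -> x != k.
  by move=> kB xB; apply: contraNneq kB => <-.
have cardl (B l : {set 'I_n}) : l \subset B -> #|B| = (#|l| + #|B :\: l|)%N.
  by move=> sl; rewrite -(cardsID l B) (setIidPr sl).
have ksym : k \notin symdiff i0 j0.
  by rewrite !inE (negPf ki0) (negPf kj0).
have Dk (B l : {set 'I_n}) : k \notin l -> (k |: B) :\: l = k |: (B :\: l).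
  move=> kl; apply/setP => x; rewrite !inE; case: eqP => // ->; by rewrite kl.
have IkN (B C : {set 'I_n}) : k \notin B -> (k |: C) :&: B = C :&: B.
  by move=> kB; apply/setP => x; rewrite !inE; case: eqP => // ->; rewrite (negPf kB) !andbF.
have dkP (l : {set 'I_n}) : d k * P s (i0 :\: l) =
    eps #|i0 :\: l| *: (P s (i0 :\: l) * d k).
  apply: comm_set => //; first exact: sD.
  by move=> x /setDP[xi _]; rewrite cdN // (neqk i0).
have Qck (l : {set 'I_n}) : Q s (j0 :\: l) * c k =
    eps #|j0 :\: l| *: (c k * Q s (j0 :\: l)).
  (* [comm_set] moves a factor rightwards, so the relation is proved in the opposite direction; the
     sign is its own inverse. *)
  have -> : c k * Q s (j0 :\: l) = eps #|j0 :\: l| *: (Q s (j0 :\: l) * c k).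
    apply: comm_set => //; first exact: sDr.
    by move=> x /setDP[xj _]; rewrite [in RHS]cdN ?opprK // eq_sym (neqk j0).
  by rewrite scalerA -signr_odd -expr2 sqrr_sign scale1r.
rewrite !rev_rcons; case: ifP => ki; case: ifP => kj.
- have -> : (k |: i0) :&: (k |: j0) = k |: (i0 :&: j0) by rewrite -setUIr.
  have -> : symdiff (k |: i0) (k |: j0) = symdiff i0 j0.
    apply/setP => x; rewrite !inE; case: eqP => //= ->.
    by rewrite (negPf ki0) (negPf kj0).
  rewrite big_subsetU1; last by rewrite inE (negPf ki0).
  rewrite oprod_rconsU1 // oprod_consU1 // !cardsU1 ki0 kj0 !add1n.
  (* Since $(|i_0|+1)(|j_0|+1)=|i_0||j_0|+|i_0|+|j_0|+1$, the inductive product appears with its own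
     sign between [d k] and [c k]. *)
  transitivity (eps (#|i0| + #|j0|).+1 *:
      (d k * (eps (#|i0| * #|j0|) *: (Q s j0 * P s i0)) * c k)).
    rewrite -scalerAr -scalerAl scalerA -exprD !mulrA; congr (_ *: _).
    by apply: eps_eq; rewrite /= !oddD !oddM /=; do 2!case: odd.
  rewrite IH mulr_sumr mulr_suml scaler_sumr.
  apply: eq_bigr => l /subl [li lj kl ekl].
  rewrite cardsU1 kl inv_sumU1r //; last first.
    move=> x; rewrite !inE => /orP[]/andP[_ xin]; apply: e_asym; apply: ek.
      exact: si0.
    exact: sj0.
  have -> : (k |: i0) :\: (k |: l) = i0 :\: l.
    apply/setP => x; rewrite !inE; case: eqP => //= ->; by rewrite (negPf ki0) andbF.
  have -> : (k |: j0) :\: (k |: l) = j0 :\: l.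
    apply/setP => x; rewrite !inE; case: eqP => //= ->; by rewrite (negPf kj0) andbF.
  rewrite !Dk // oprod_rconsU1 // oprod_consU1 //.
  rewrite ![oprod (rcons s k) c _]oprod_rcons_notin ?kD //.
  rewrite ![oprod (k :: rev s) d _]oprod_cons_notin ?kD //.
  rewrite -scalerAr -scalerAl scalerA !mulrA dkP -!scalerAl -!mulrA Qck.
  rewrite -!scalerAr !scalerA -!exprD !mulrA.
  (* In $d_kc_k=1-c_kd_k$ the constant gives the term of [k |: l] and the normally ordered part
     gives the term of [l]. *)
  rewrite -[_ * d k * c k]mulrA cd1 mulrBr mulr1 mulrBl mulrA scalerBr addrC -scaleNr.
  rewrite epsN.
  congr (_ *: _ + _ *: _); apply: eps_eq;
  rewrite /= !oddD (cardl _ _ li) (cardl _ _ lj) !oddD /=;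
  by do 4!case: odd.
(* Here [k] lies in [i] only. Passing [c k] over $j_0\setminus l$ instead of $j_0$ leaves the sign
   of $|l|$, which matches the $|l|$ inversions that [k] adds to the symmetric difference. The next
   case is the mirror image. *)
- rewrite IkN //.
  have -> : symdiff (k |: i0) j0 = k |: symdiff i0 j0.
    apply/setP => x; rewrite !inE; case: eqP => //= ->; by rewrite (negPf kj0).
  rewrite oprod_rconsU1 // oprod_cons_notin // cardsU1 ki0 add1n.
  transitivity (eps #|j0| *: ((eps (#|i0| * #|j0|) *: (Q s j0 * P s i0)) * c k)).
    by rewrite -scalerAl scalerA -exprD mulSn mulrA.
  rewrite IH mulr_suml scaler_sumr.
  apply: eq_bigr => l /subl [li lj kl ekl].
  rewrite inv_sumU1l // Dk // oprod_rconsU1 // oprod_cons_notin ?kD //.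
  rewrite -scalerAl scalerA -[_ * Q s _ * c k]mulrA Qck -!scalerAr !scalerA -!exprD !mulrA.
  congr (_ *: _); apply: eps_eq.
  rewrite !oddD (cardl _ _ lj) !oddD; by do 3!case: odd.
- rewrite setIC IkN // setIC.
  have -> : symdiff i0 (k |: j0) = k |: symdiff i0 j0.
    apply/setP => x; rewrite !inE; case: eqP => //= ->; by rewrite (negPf ki0).
  rewrite oprod_consU1 // oprod_rcons_notin // cardsU1 kj0 add1n.
  transitivity (eps #|i0| *: (d k * (eps (#|i0| * #|j0|) *: (Q s j0 * P s i0)))).
    by rewrite -scalerAr scalerA -exprD mulnS mulrA.
  rewrite IH mulr_sumr scaler_sumr.
  apply: eq_bigr => l /subl [li lj kl ekl].
  rewrite inv_sumU1l // Dk // oprod_consU1 // oprod_rcons_notin ?kD //.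
  rewrite -scalerAr scalerA !mulrA dkP -!scalerAl !scalerA -!exprD.
  congr (_ *: _); apply: eps_eq.
  rewrite !oddD (cardl _ _ li) !oddD; by do 3!case: odd.
rewrite oprod_rcons_notin // oprod_cons_notin // IH.
apply: eq_bigr => l /subl [li lj kl ekl].
by rewrite oprod_rcons_notin ?kD // oprod_cons_notin ?kD.
Qed.

(** The term [l = set0] of [wick] is [P s i * Q s j] itself and cancels; the subtraction puts the
    extra 1 in the exponents. *)
Corollary wick_supercommutator (s : seq 'I_n) (i j : {set 'I_n}) :
  uniq s -> pairwise e s -> s =i predT ->
  P s i * Q s j - eps (#|i| * #|j|) *: (Q s j * P s i) =
  \sum_(l : {set 'I_n} | (l != set0) && (l \subset i :&: j))
    eps (1 + #|l| + inv_sum e (symdiff i j) l)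
      *: (P s (i :\: l) * Q s (j :\: l)).
Proof.
move=> us es sT; rewrite wick // => [|x _|x _]; rewrite ?sT //.
rewrite sum_subset_neq0 !setD0 cards0 inv_sum0r scale1r opprD addNKr -sumrN.
by apply: eq_bigr => l _; rewrite -scaleNr epsN.
Qed.

End Wick.

(** * Blades *)

Section Generation.
Variables (K : numFieldType) (X : vectType K) (E : falgType K).

Definition agenv_val (U : {vspace E}) (w : subvs_of <<U>>%AS) : E := vsval w.

Fact agenv_val_is_linear U : linear (@agenv_val U).
Proof. exact: linearP. Qed.

(** The unit of the subalgebra is its [algid], which equals [1] because a generated subalgebra
    contains [1]. *)
Fact agenv_val_is_monoid_morphism U : monoid_morphism (@agenv_val U).
Proof. by split=> //=; apply/eqP; rewrite algid_eq1 memvE sub1_agenv. Qed.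

HB.instance Definition _ U := GRing.isLinear.Build K (subvs_of <<U>>%AS) E _
  (@agenv_val U) (@agenv_val_is_linear U).
HB.instance Definition _ U := GRing.isMonoidMorphism.Build (subvs_of <<U>>%AS) E
  (@agenv_val U) (@agenv_val_is_monoid_morphism U).

(* By uniqueness, [E -> agenv -> E] is the identity. *)
Lemma exterior_generated (emb : 'Hom(X, E)) :
  is_exterior_algebra emb -> agenv (limg emb) = fullv.
Proof.
case=> emb2 univ; set B := <<limg emb>>%AS.
have embB x : emb x \in B by apply: (subvP (sub_agenv _)); rewrite memv_img ?memvf.
pose f : {linear X -> subvs_of B} := (vsproj B) \o emb.
have f2 : square_zero f by move=> x; apply: val_inj; rewrite /= !vsprojK ?emb2.
have [h0 h0f _] := univ (subvs_of B) f f2.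
have [h _ h_uniq] := univ E emb emb2.
pose vh0 : {lrmorphism E -> E} := @agenv_val (limg emb) \o h0.
have idh := h_uniq idfun (fun=> erefl).
have vh : vh0 =1 h.
  by apply: h_uniq => x /=; rewrite h0f /agenv_val /= vsprojK.
apply/eqP; rewrite eqEsubv subvf; apply/subvP => x _.
by have /= -> := idh x; rewrite -vh subvsP.
Qed.

End Generation.

Lemma prodv_span_sub (K : fieldType) (E : falgType K) (s t : seq E) (W : {vspace E}) :
  (forall x y, x \in s -> y \in t -> x * y \in W) -> (<<s>> * <<t>> <= W)%VS.
Proof.
move=> stW; apply/prodvP => x y /(@coord_span _ _ _ (in_tuple s)) ->.
move=> /(@coord_span _ _ _ (in_tuple t)) ->.
rewrite mulr_suml memv_suml // => i _; rewrite mulr_sumr memv_suml // => j _.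
by rewrite -scalerAl -scalerAr !memvZ // stW // mem_nth.
Qed.

Lemma index_enum_ord n : index_enum 'I_n = enum 'I_n.
Proof. by rewrite -deprecated_filter_index_enum filter_predT. Qed.

Lemma pairwise_enum_ord n : pairwise (fun x y : 'I_n => x < y)%N (enum 'I_n).
Proof.
have := iota_ltn_sorted 0 n; rewrite -val_enum_ord (sorted_pairwise ltn_trans).
by rewrite pairwise_map.
Qed.

(** * Blades span the algebra, its grades and its parity spaces *)

Section Blades.
Variables (K : numFieldType) (X : vectType K) (E : falgType K).
Variables (emb : 'Hom(X, E)) (n : nat) (v : n.-tuple X).
Hypothesis emb2 : square_zero emb.

Notation blade := (blade emb v).
Notation w k := (emb (tnth v k)).

Lemma emb_anticomm x y : emb x * emb y = - (emb y * emb x).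
Proof.
apply/eqP; rewrite -addr_eq0; have := emb2 (x + y).
by rewrite linearD mulrDl !mulrDr !emb2 add0r addr0 => ->.
Qed.

Lemma bladeE r : blade r = oprod (enum 'I_n) (fun k => w k) r.
Proof. by rewrite /blade index_enum_ord. Qed.

(** The vector anticommutes past the factors of smaller index to its own place, where it either
    meets its copy and squares to zero or completes the blade. The sign is left existential: later
    arguments use only that it squares to one. *)
Lemma mul_emb_blade k r : exists b : bool,
  w k * blade r = if k \in r then 0 else (-1) ^+ b *: blade (k |: r).
Proof.
have us := enum_uniq 'I_n; rewrite !bladeE /oprod.
have ke : k \in enum 'I_n by rewrite mem_enum.
move: us; case/splitPr: _ / ke => s1 s2; rewrite cat_uniq /= negb_or.
rewrite -!andbA => /and5P[_ ks1 _ ks2 _].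
have comm (s : seq 'I_n) : w k * (\prod_(i <- s | i \in r) w i) =
    (-1) ^+ (1 * count (mem r) s)%N *: (\prod_(i <- s | i \in r) w i * w k).
  by apply: sign_comm_prod => i _; rewrite expr1 scaleN1r emb_anticomm.
exists (odd (count (mem r) s1)); rewrite signr_odd !big_cat !big_cons /=.
rewrite mulrA comm mul1n -scalerAl -mulrA setU11.
have rU (s : seq 'I_n) : k \notin s ->
    \prod_(i <- s | i \in k |: r) w i = \prod_(i <- s | i \in r) w i.
  move=> ks; rewrite big_seq_cond [RHS]big_seq_cond; apply: eq_bigl => x.
  by rewrite in_setU1; case: eqP => // ->; rewrite (negPf ks).
by rewrite !rU //; case: ifP => // _; rewrite [w k * _]mulrA emb2 mul0r mulr0 scaler0.
Qed.

Lemma blade0 : blade set0 = 1.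
Proof. by rewrite /blade big_set0. Qed.

Lemma blade1 k : blade [set k] = w k.
Proof. by rewrite /blade big_set1. Qed.

Lemma blade_grade r : blade r \in grade emb #|r|.
Proof.
rewrite bladeE /grade -(count_mem_set (enum_uniq 'I_n)) => [|x _]; last by rewrite mem_enum.
rewrite /oprod; elim: (enum 'I_n) => [|k s IHs]; first by rewrite big_nil memv_line.
rewrite big_cons /=; case: ifP => // _.
by rewrite add1n expvSl memv_mul ?memv_img ?memvf.
Qed.

Definition blade_span (P : pred {set 'I_n}) : {vspace E} :=
  <<[seq blade r | r in P]>>%VS.

Lemma blade_in_span (P : pred {set 'I_n}) r : P r -> blade r \in blade_span P.
Proof. by move=> Pr; apply/memv_span/image_f. Qed.

Lemma blade_span_sub (P : pred {set 'I_n}) (W : {vspace E}) :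
  (forall r, P r -> blade r \in W) -> (blade_span P <= W)%VS.
Proof. by move=> PW; apply/span_subvP => _ /imageP[r Pr ->]; apply: PW. Qed.

Lemma mul_emb_blade_in (P : pred {set 'I_n}) (k : 'I_n) (r : {set 'I_n}) :
  (k \notin r -> P (k |: r)) -> w k * blade r \in blade_span P.
Proof.
move=> Pkr; have [b ->] := mul_emb_blade k r.
by case: ifPn => [_|/Pkr Pk]; rewrite ?mem0v // memvZ // blade_in_span.
Qed.

Hypothesis v_basis : basis_of fullv v.

Lemma limg_emb : limg emb = <<[seq w k | k : 'I_n]>>%VS.
Proof.
rewrite -(span_basis v_basis) limg_span; congr (<<_>>)%VS.
by rewrite -[in LHS](map_tnth_enum v) -map_comp.
Qed.

Lemma mul_limg_blade_span (P Q : pred {set 'I_n}) :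
  (forall (k : 'I_n) (r : {set 'I_n}), P r -> k \notin r -> Q (k |: r)) ->
  (limg emb * blade_span P <= blade_span Q)%VS.
Proof.
move=> PQ; rewrite limg_emb; apply: prodv_span_sub => x y /imageP[k _ ->].
by case/imageP => r Pr ->; apply: mul_emb_blade_in; apply: PQ.
Qed.

Lemma grade_blade_span p : (grade emb p <= blade_span (fun r => #|r| == p))%VS.
Proof.
elim: p => [|p IHp].
  by rewrite /grade expv0 -memvE -blade0 blade_in_span // cards0.
rewrite /grade expvSl (subv_trans (prodvSr _ IHp)) //.
by apply: mul_limg_blade_span => k r /eqP rp kr; rewrite cardsU1 kr rp.
Qed.

(** The span contains [1] and is stable under left multiplication by vectors, hence contains the
    algebra they generate. *)
Lemma blade_span_full : is_exterior_algebra emb -> blade_span predT = fullv.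
Proof.
move=> ext; apply/eqP; rewrite eqEsubv subvf -(exterior_generated ext).
apply: agenv_sub_modl; last by apply: mul_limg_blade_span.
by rewrite -memvE -blade0 blade_in_span.
Qed.

Lemma parity_spaceE b :
  parity_space emb b = blade_span (fun r => odd #|r| == b).
Proof.
have dimX : \dim {:X} = n by rewrite -(size_basis v_basis).
apply/eqP; rewrite eqEsubv; apply/andP; split.
  apply/subv_sumP => p /eqP <-; apply: subv_trans (grade_blade_span p) _.
  by apply: blade_span_sub => r /eqP <-; apply: blade_in_span.
apply: blade_span_sub => r rb.
(* The sum defining [parity_space] stops at grade $\dim X$, so the size of [r] must be bounded. *)
have lt_r : (#|r| < (\dim {:X}).+1)%N.
  by rewrite dimX ltnS -[X in (_ <= X)%N]card_ord max_card.
have /subvP : (grade emb (Ordinal lt_r) <= parity_space emb b)%VS.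
  exact: (@sumv_sup _ _ _ (Ordinal lt_r)).
by apply; apply: blade_grade.
Qed.

End Blades.

(** * Nondegeneracy of the product and orthonormality of the blades *)

Section Orthonormality.
Variables (K : numFieldType) (theta : {rmorphism K -> K}).

Section Dot.
Variables (U : vectType K) (dot : {dot U for theta}).

Lemma dot_span0 (s t : seq U) x y :
  (forall x y, x \in s -> y \in t -> dot x y = 0) ->
  x \in <<s>>%VS -> y \in <<t>>%VS -> dot x y = 0.
Proof.
move=> st0 /(@coord_span _ _ _ (in_tuple s)) ->.
move=> /(@coord_span _ _ _ (in_tuple t)) ->.
rewrite linear_sumlz big1 // => i _; rewrite linear_sumr big1 // => j _.
by rewrite linearZl_LR linearZr_LR /= st0 ?mulr0 ?mem_nth.
Qed.

Lemma dot_self_eq0 x : dot x x = 0 -> x = 0.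
Proof.
move=> x0; apply/eqP; apply/negPn/negP => /(neq0_dnorm_gt0 (s := dot)).
by rewrite x0 ltxx.
Qed.

(** The difference is orthogonal to a spanning family, hence to itself, hence zero. Contractions are
    known only through adjunction, so their identities are proved by this test. *)
Lemma dot_span_inj (t : seq U) x x' : <<t>>%VS = fullv ->
  {in t, forall y, dot x y = dot x' y} -> x = x'.
Proof.
move=> tfull xx'; apply/eqP; rewrite -subr_eq0; apply/eqP/dot_self_eq0.
apply: (@dot_span0 [:: x - x'] t); rewrite ?memv_span1 ?tfull ?memvf //.
move=> _ y /[!inE] /eqP -> yt; apply/eqP; rewrite linearBl subr_eq0.
exact/eqP/xx'.
Qed.

Lemma dotC_eq0 x y : dot x y = 0 -> dot y x = 0.
Proof.
move=> xy0; apply/eqP; rewrite hermC mul1r fmorph_eq0; exact/eqP.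
Qed.

(** [orthonormal] records orthogonality only for pairs in list order; Hermitian symmetry supplies
    the other order. *)
Lemma orthonormal_tnth n (v : n.-tuple U) i j :
  orthonormal dot v -> dot (tnth v i) (tnth v j) = (i == j)%:R.
Proof.
case/andP=> /allP v1 vo.
have lt_dot a b (s : seq U) : (a < b < size s)%N -> pair_ortho_rec dot s ->
    dot s`_a s`_b = 0.
  elim: s a b => [|x s IHs]; first by move=> a b /andP[].
  move=> [|a] [|b] //=; rewrite ?ltnS => ab.
    move=> /andP[+ _]; rewrite /ortho_rec /= andbT => /allP xs.
    exact/eqP/xs/mem_nth.
  by case/andP=> _; apply: IHs.
rewrite !(tnth_nth 0) -val_eqE /=; case: ltngtP => [ij|ji|->].
- by rewrite lt_dot ?ij ?size_tuple /=.
- by apply: dotC_eq0; rewrite lt_dot ?ji ?size_tuple /=.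
by apply/eqP/v1/mem_nth; rewrite size_tuple.
Qed.

End Dot.

Variables (X : vectType K) (E : falgType K) (dotX : {dot X for theta}).
Variables (emb : 'Hom(X, E)) (n : nat) (v : n.-tuple X).
Variable dotE : {dot E for theta}.
Hypothesis v_orthonormal : orthonormal dotX v.
Hypothesis dotE_induced : is_induced_product emb dotX dotE.

Notation blade := (blade emb v).

(** This is the form to which the Gram determinant applies. Keeping [p] separate from [#|r|] lets
    two sets of equal size share one index type. *)
Lemma blade_enum_val p (r : {set 'I_n}) (rp : #|r| = p) :
  blade r = \prod_(i < p) emb (tnth v (enum_val (cast_ord (esym rp) i))).
Proof.
rewrite /Defs.blade -big_filter deprecated_filter_index_enum.
have e : p = size (enum r) by rewrite -cardE.
have castE m (F : 'I_m -> E) (em : p = m) : \prod_i F i = \prod_i F (cast_ord em i).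
  by case: m / em F => F; apply: eq_bigr => i _; rewrite cast_ord_id.
rewrite [LHS]big_tnth (castE _ _ e); apply: eq_bigr => i _; congr (emb (tnth v _)).
set k := enum_val _; rewrite (tnth_nth k) /=.
by rewrite /k [in RHS](enum_val_nth k).
Qed.

(** Different sizes lie in orthogonal grades, and equal sets have the identity as Gram matrix. For
    distinct sets of one size, an index of [s] outside [r] gives a zero row. *)
Lemma dot_blade r s : dotE (blade r) (blade s) = (r == s)%:R.
Proof.
have [grades det_dot] := dotE_induced.
have [rs|rs] := eqVneq #|r| #|s|; last first.
  have -> : (r == s) = false by apply: contraNF rs => /eqP ->.
  by apply: (grades #|s| #|r|); rewrite 1?eq_sym // blade_grade.
have [ers|neq_rs] := eqVneq r s.
  move: rs; rewrite ers => rs.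
  rewrite [in X in dotE X](blade_enum_val rs) (blade_enum_val (erefl #|s|)).
  rewrite [LHS]det_dot -[RHS](det1 _ #|s|); congr (\det _); apply/matrixP => i j.
  rewrite !mxE /inner orthonormal_tnth // (inj_eq enum_val_inj).
  by rewrite -val_eqE /= eq_sym.
rewrite (blade_enum_val rs) (blade_enum_val (erefl #|s|)) [LHS]det_dot.
have [k ks kr] : exists2 k, k \in s & k \notin r.
  by apply/subsetPn; apply: contraNN neq_rs => sr; rewrite eq_sym eqEcard sr rs leqnn.
rewrite (expand_det_row _ (enum_rank_in ks k)) big1 // => j _.
rewrite !mxE /inner orthonormal_tnth // cast_ord_id enum_rankK_in //.
case: eqP => [kE|_]; last by rewrite mul0r.
by case/negP: kr; rewrite -kE enum_valP.
Qed.

End Orthonormality.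

(** * Creation and annihilation operators *)

Section Parity.
Variables (K : numFieldType) (X : vectType K) (E : falgType K).
Variable emb : 'Hom(X, E).
Import FalgLfun.

(** Parities add under composition, so the parity is that of the number of factors. *)
Lemma has_parity_oprod n (s : seq 'I_n) (F : 'I_n -> 'End(E)) (r : {set 'I_n}) :
  (forall k, has_parity emb true (F k)) ->
  has_parity emb (odd (count (mem r) s)) (oprod s F r).
Proof.
move=> Fodd; rewrite /oprod; elim: s => [|k s IHs] t.
  by rewrite big_nil /= lim1g.
rewrite big_cons /=; case: ifP => // _; rewrite add1n /= limg_comp.
apply: subv_trans (limgS _ (Fodd k t)) _; apply: subv_trans (IHs _) _.
by rewrite addTb addbN -addNb.
Qed.

End Parity.

(** * Creation and annihilation operators of single indices and their relations *)

Section Fock.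
Variables (K : numFieldType) (theta : {rmorphism K -> K}).
Variables (X : vectType K) (E : falgType K) (dotX : {dot X for theta}).
Variables (emb : 'Hom(X, E)) (n : nat) (v : n.-tuple X).
Variables (dotE : {dot E for theta}) (lcontr : E -> E -> E).
Hypothesis v_basis : basis_of fullv v.
Hypothesis v_orthonormal : orthonormal dotX v.
Hypothesis E_exterior : is_exterior_algebra emb.
Hypothesis dotE_induced : is_induced_product emb dotX dotE.
Hypothesis lcontrP : is_left_contraction dotE lcontr.
Import FalgLfun.

Notation blade := (blade emb v).
Notation w k := (emb (tnth v k)).
Notation a := (annihilation emb v lcontr).
Notation adag := (creation emb v).
Notation blade_span := (blade_span emb v).
Notation C := (fun k => amull (w k)).
Notation D := (fun k => a [set k]).

Let emb2 : square_zero emb. Proof. by case: E_exterior. Qed.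

Let blades_full : <<[seq blade r | r : {set 'I_n}]>>%VS = fullv.
Proof. exact: (blade_span_full emb2 v_basis E_exterior). Qed.

Let dot_blades := dot_blade v_orthonormal dotE_induced.

(** Adjunction moves [M] to the other argument, where linearity is that of [dotE]. It makes the
    [linfun] in [annihilation] the contraction itself. *)
Lemma lcontr_is_linear M : linear (lcontr M).
Proof.
move=> c N N'; apply: (dot_span_inj (dot := dotE) blades_full) => L _.
have adj (N0 : E) : dotE (lcontr M N0) L = dotE N0 (M * L) by exact: lcontrP.
by rewrite adj !linearPl /= -!adj.
Qed.

Lemma annihilationE r N : a r N = lcontr (blade r) N.
Proof.
pose lin := GRing.isLinear.Build K E E _ (lcontr (blade r)) (@lcontr_is_linear _).
pose f : {linear E -> E} := HB.pack (lcontr (blade r)) lin.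
exact: (lfunE f).
Qed.

Lemma dot_annihilation r N L : dotE (a r N) L = dotE N (blade r * L).
Proof. by rewrite annihilationE; exact: lcontrP. Qed.

(** Adjunction strips the factors of the blade from the left, so the smallest index acts first;
    since [f * g] applies [f] first, the product is increasing. *)
Lemma annihilation_oprod r : a r = oprod (enum 'I_n) D r.
Proof.
apply/lfunP => N; apply: (dot_span_inj (dot := dotE) blades_full) => L _.
rewrite dot_annihilation bladeE /oprod.
elim: (enum 'I_n) N => [|k s IHs] N; first by rewrite !big_nil mul1r id_lfunE.
rewrite !big_cons; case: ifP => // _.
by rewrite [_ * _ : 'End(E)]/GRing.mul /= comp_lfunE -IHs dot_annihilation blade1 mulrA.
Qed.

Lemma creation_oprod r : adag r = oprod (rev (enum 'I_n)) C r.
Proof.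
have -> : adag r = amull (blade r) by [].
rewrite bladeE /oprod; elim: (enum 'I_n) => [|k s IHs].
  by rewrite !big_nil amull1.
rewrite rev_cons big_rcons big_cons; case: ifP => _; last by rewrite /= mulr1.
by rewrite amullM IHs.
Qed.

(** By adjunction the product with any blade becomes one between [blade s] and either zero or a
    signed blade containing [k], which is orthogonal to it. *)
Lemma D_blade (k : 'I_n) (s : {set 'I_n}) : k \notin s -> D k (blade s) = 0.
Proof.
move=> ks; apply: (dot_span_inj (dot := dotE) blades_full) => _ /imageP[t _ ->].
rewrite linear0l dot_annihilation blade1.
have [b ->] := mul_emb_blade v emb2 k t; case: ifP => _; first by rewrite linear0r.
rewrite linearZr_LR /= dot_blades; case: eqP => [st|_]; last by rewrite mulr0.
by rewrite st setU11 in ks.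
Qed.

(** Tested against [blade s], the sign of [w k * blade s] occurs in both arguments and cancels;
    against every other blade both sides give zero. *)
Lemma D_emb_blade (k : 'I_n) (s : {set 'I_n}) : k \notin s -> D k (w k * blade s) = blade s.
Proof.
move=> ks; apply: (dot_span_inj (dot := dotE) blades_full) => _ /imageP[t _ ->].
rewrite dot_annihilation blade1 dot_blades.
have [b] := mul_emb_blade v emb2 k s; rewrite (negPf ks) => wks.
have [<-|neq_st] := eqVneq s t.
  rewrite wks linearZl_LR linearZr_LR /= dot_blades eqxx rmorph_sign /= mulr1.
  by rewrite -expr2 sqrr_sign.
have [c ->] := mul_emb_blade v emb2 k t; case: ifPn => kt; first by rewrite linear0r.
rewrite wks linearZl_LR linearZr_LR /= dot_blades; case: eqP => [st|_].
  by move: neq_st; rewrite -(setU1K ks) st setU1K // eqxx.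
by rewrite !mulr0.
Qed.

(* For fixed [k], the blades avoiding [k] and their products with [v_k] span. *)
Lemma lfun_eq_blades (k : 'I_n) (f g : 'End(E)) :
  (forall s : {set 'I_n}, k \notin s ->
    f (blade s) = g (blade s) /\ f (w k * blade s) = g (w k * blade s)) ->
  f = g.
Proof.
move=> fg; apply/(fullv_lfunP _ _ blades_full) => _ /imageP[s _ ->].
have [ks|/fg[]//] := boolP (k \in s).
have ksD : k \notin s :\ k by rewrite !inE eqxx.
have [b] := mul_emb_blade v emb2 k (s :\ k); rewrite (negPf ksD) setD1K // => wks.
have -> : blade s = (-1) ^+ b *: (w k * blade (s :\ k)).
  by rewrite wks scalerA -expr2 sqrr_sign scale1r.
by rewrite !linearZ /=; have [_ ->] := fg _ ksD.
Qed.

Lemma lfun_mulE (f g : 'End(E)) N : (f * g) N = g (f N).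
Proof. exact: comp_lfunE. Qed.

Lemma lfun_oneE N : (1 : 'End(E)) N = N.
Proof. exact: id_lfunE. Qed.

Lemma C_anticomm j k : C j * C k = - (C k * C j).
Proof. by rewrite /= -!amullM -linearN (emb_anticomm emb2). Qed.

(** This is the adjoint of the anticommutation of vectors. *)
Lemma D_anticomm j k : D j * D k = - (D k * D j).
Proof.
apply/lfunP => N; apply: (dot_span_inj (dot := dotE) blades_full) => L _.
have adj x y : dotE (D x (D y N)) L = dotE N (w y * w x * L).
  by rewrite !dot_annihilation !blade1 mulrA.
rewrite opp_lfunE linearNl !lfun_mulE; apply: etrans (adj k j) _.
by apply: etrans (congr1 -%R (esym (adj j k))); rewrite emb_anticomm // mulNr linearNr.
Qed.

Lemma C_blade_notin (k j : 'I_n) (s : {set 'I_n}) : k \notin s -> j != k ->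
  exists (c : K) (t : {set 'I_n}), k \notin t /\ w j * blade s = c *: blade t.
Proof.
move=> ks jk; have [b ->] := mul_emb_blade v emb2 j s.
(* When [j] is in [s] the product vanishes, and [s] itself serves with coefficient zero. *)
case: ifP => js; first by exists 0, s; rewrite scale0r.
by exists ((-1) ^+ b), (j |: s); split; rewrite // !inE eq_sym (negPf jk).
Qed.

(** On blades avoiding [k] both sides vanish. On their products with $v_k$, exchanging $v_j$ and
    $v_k$ makes both sides $-v_j\wedge v_s$. *)
Lemma CD_anticomm j k : j != k -> C j * D k = - (D k * C j).
Proof.
move=> jk; apply: (@lfun_eq_blades k) => s ks.
rewrite !opp_lfunE !lfun_mulE !lfunE /= D_blade // D_emb_blade // mulr0 oppr0.
have [c [t [kt wjs]]] := C_blade_notin ks jk.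
rewrite mulrA emb_anticomm // mulNr -mulrA wjs linearN /= -scalerAr !linearZ /=.
by rewrite D_blade // D_emb_blade // scaler0.
Qed.

(** The two products are complementary projections: [C k * D k] fixes the blades avoiding [k] and
    kills their products with $v_k$, and [D k * C k] does the reverse. *)
Lemma CD_same k : C k * D k = 1 - D k * C k.
Proof.
apply: (@lfun_eq_blades k) => s ks.
rewrite !add_lfunE !opp_lfunE !lfun_mulE !lfun_oneE !lfunE /=.
rewrite D_blade // D_emb_blade // mulrA emb2 mul0r linear0 mulr0 subr0.
by rewrite subrr.
Qed.

(** * Parities of the operators and the even-odd decomposition *)

Lemma has_parityP b (S : 'End(E)) :
  (forall r, S (blade r) \in blade_span (fun t => odd #|t| == b (+) odd #|r|)) ->
  has_parity emb b S.
Proof.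
move=> Sb c; rewrite !(parity_spaceE emb2 v_basis) limg_span; apply/span_subvP => x.
by case/mapP => y /imageP[r /eqP <- ->] ->; apply: Sb.
Qed.

Lemma C_odd k : has_parity emb true (C k).
Proof.
apply: has_parityP => r; rewrite lfunE /=; apply: mul_emb_blade_in => // kr.
by rewrite cardsU1 kr.
Qed.

Lemma D_odd k : has_parity emb true (D k).
Proof.
apply: has_parityP => r; have [kr|kr] := boolP (k \in r); last first.
  by rewrite D_blade // mem0v.
have ksD : k \notin r :\ k by rewrite !inE eqxx.
have [b] := mul_emb_blade v emb2 k (r :\ k); rewrite (negPf ksD) setD1K // => wks.
have -> : blade r = (-1) ^+ b *: (w k * blade (r :\ k)).
  by rewrite wks scalerA -expr2 sqrr_sign scale1r.
rewrite linearZ /= D_emb_blade // memvZ // blade_in_span //.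
by rewrite [in X in _ == X](cardsD1 k r) kr /= negbK.
Qed.

Lemma annihilation_parity (r : {set 'I_n}) : has_parity emb (odd #|r|) (a r).
Proof.
rewrite annihilation_oprod -(count_mem_set (enum_uniq 'I_n)); last first.
  by move=> x _; rewrite mem_enum.
by apply: has_parity_oprod => k; apply: D_odd.
Qed.

Lemma creation_parity (r : {set 'I_n}) : has_parity emb (odd #|r|) (adag r).
Proof.
rewrite creation_oprod -(@count_mem_set _ (rev (enum 'I_n))) ?rev_uniq ?enum_uniq //.
  by apply: has_parity_oprod => k; apply: C_odd.
by move=> x _; rewrite mem_rev mem_enum.
Qed.

Lemma parity_sum : (parity_space emb false + parity_space emb true = fullv)%VS.
Proof.
apply/eqP; rewrite eqEsubv subvf -(blade_span_full emb2 v_basis E_exterior).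
apply: blade_span_sub => r _; rewrite !(parity_spaceE emb2 v_basis).
case r_odd: (odd #|r|).
  by apply: (subvP (addvSr _ _)); apply: blade_in_span; rewrite r_odd.
by apply: (subvP (addvSl _ _)); apply: blade_in_span; rewrite r_odd.
Qed.

(** Blades of different parity are orthogonal, so a common element is orthogonal to itself. *)
Lemma parity_cap : (parity_space emb false :&: parity_space emb true = 0)%VS.
Proof.
apply/eqP; rewrite -subv0; apply/subvP => x; rewrite memv_cap memv0.
rewrite !(parity_spaceE emb2 v_basis) => /andP[x0 x1]; apply/eqP.
apply: (dot_self_eq0 (dot := dotE)); apply: dot_span0 x0 x1 => _ y /imageP[r r0 ->].
case/imageP=> s s1 ->; rewrite dot_blades; case: eqP => // rs.
by move: r0 s1; rewrite rs => /eqP r0 /eqP; rewrite r0.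
Qed.

Lemma supercomm_parity (p q : nat) (S T : 'End(E)) :
  has_parity emb (odd p) S -> has_parity emb (odd q) T ->
  supercomm emb S T = (S \o T)%VF - (-1) ^+ (p * q)%N *: (T \o S)%VF.
Proof.
move=> Sp Tq; rewrite (supercommE parity_sum parity_cap Sp Tq).
by rewrite -(signr_odd _ (p * q)) oddM; case: odd; case: odd.
Qed.

(** Each factor of the second product passes the whole first one with sign $(-1)^{|i|}$. Shared
    indices obey the same rule, as the anticommutation is assumed also for [x = y]. *)
Lemma oprod_supercommute (F : 'I_n -> 'End(E)) (s : seq 'I_n) (i j : {set 'I_n}) :
  uniq s -> s =i predT -> (forall x y, F x * F y = - (F y * F x)) ->
  oprod s F i * oprod s F j =
  (-1) ^+ (#|i| * #|j|)%N *: (oprod s F j * oprod s F i).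
Proof.
move=> us sT FN; have card (B : {set 'I_n}) : count (mem B) s = #|B|.
  by apply: count_mem_set => // x _; rewrite sT.
rewrite -(card i) -(card j); apply: sign_comm_prod => k _.
have -> : F k * oprod s F i = (-1) ^+ (1 * count (mem i) s)%N *: (oprod s F i * F k).
  by apply: sign_comm_prod => x _; rewrite expr1 scaleN1r FN.
by rewrite mul1n scalerA -expr2 sqrr_sign scale1r.
Qed.

(** * The four supercommutators *)

Section Relations.
Variables i j : {set 'I_n}.

Lemma supercomm_annihilation : supercomm emb (a i) (a j) = 0.
Proof.
rewrite (supercomm_parity (annihilation_parity i) (annihilation_parity j)).
rewrite !lfun_compE !annihilation_oprod.
rewrite (oprod_supercommute _ _ (enum_uniq _) _ D_anticomm) ?subrr; last first.
  by move=> x; rewrite mem_enum.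
by rewrite mulnC subrr.
Qed.

Lemma supercomm_creation : supercomm emb (adag i) (adag j) = 0.
Proof.
rewrite (supercomm_parity (creation_parity i) (creation_parity j)).
rewrite !lfun_compE !creation_oprod.
rewrite (oprod_supercommute _ _ _ _ C_anticomm) ?rev_uniq ?enum_uniq //.
  by rewrite mulnC subrr.
by move=> x; rewrite mem_rev mem_enum.
Qed.

Lemma supercomm_creation_annihilation :
  supercomm emb (adag i) (a j) =
  \sum_(l : {set 'I_n} | (l != set0) && (l \subset i :&: j))
    (-1) ^+ (1 + #|l| + inversions (symdiff i j) l)%N
      *: (adag (i :\: l) \o a (j :\: l))%VF.
Proof.
rewrite (supercomm_parity (creation_parity i) (annihilation_parity j)).
rewrite !lfun_compE annihilation_oprod creation_oprod mulnC.
(* In the ring of [FalgLfun] the composite $a_i^\dagger a_j$ is [a j * adag i], so [D] plays the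
   part of [c] and [i], [j] change places. *)
rewrite (@wick_supercommutator _ _ _ D C _ _ (fun x y => x < y)%N) //.
- rewrite setIC; apply: eq_bigr => l _.
  by rewrite lfun_compE annihilation_oprod creation_oprod inversions_ltE symdiffC.
- by move=> x y xy; rewrite CD_anticomm // eq_sym.
- exact: CD_same.
- by move=> x y xy; rewrite -leqNgt ltnW.
- exact: enum_uniq.
- exact: pairwise_enum_ord.
- by move=> x; rewrite mem_enum.
Qed.

Lemma supercomm_annihilation_creation :
  supercomm emb (a i) (adag j) =
  \sum_(l : {set 'I_n} | (l != set0) && (l \subset i :&: j))
    (-1) ^+ (1 + #|l| + inversions l (symdiff i j))%N
      *: (a (i :\: l) \o adag (j :\: l))%VF.
Proof.
rewrite (supercomm_parity (annihilation_parity i) (creation_parity j)).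
rewrite !lfun_compE annihilation_oprod creation_oprod mulnC.
(* Now [C] plays the part of [c] along the decreasing enumeration, so the increasing product of the
   [D] must be displayed over its reverse. *)
rewrite -[X in oprod X D](revK (enum 'I_n)).
rewrite (@wick_supercommutator _ _ _ C D _ _ (fun x y => y < x)%N) //.
- rewrite setIC; apply: eq_bigr => l _.
  by rewrite revK lfun_compE annihilation_oprod creation_oprod inversions_gtE symdiffC.
- by move=> x y xy; rewrite CD_anticomm // opprK.
- by move=> x; rewrite CD_same subKr.
- by move=> x y xy; rewrite -leqNgt ltnW.
- by rewrite rev_uniq enum_uniq.
- have gt_trans : transitive (fun x y : 'I_n => y < x)%N.
    by move=> y x z yx zy; apply: ltn_trans zy yx.
  rewrite -(sorted_pairwise gt_trans) rev_sorted.
  exact/pairwise_sorted/pairwise_enum_ord.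
- by move=> x; rewrite mem_rev mem_enum.
Qed.

End Relations.

End Fock.

Theorem proposition5p9 (R : realType) (g : geometry) (n : nat)
  (X : vectType (scalars R g)) (dotX : {dot X for conj_scalars R g})
  (dimX : \dim {:X} = n)
  (v : n.-tuple X) (v_basis : basis_of fullv v)
  (v_orthonormal : orthonormal dotX v)
  (E : falgType (scalars R g)) (emb : 'Hom(X, E))
  (E_exterior : is_exterior_algebra emb)
  (dotE : {dot E for conj_scalars R g})
  (dotE_induced : is_induced_product emb dotX dotE)
  (lcontr : E -> E -> E) (lcontrP : is_left_contraction dotE lcontr) :
  let a := annihilation emb v lcontr in
  let adag := creation emb v in
  forall i j : {set 'I_n},
  [/\ supercomm emb (a i) (a j) = 0,
      supercomm emb (adag i) (adag j) = 0,
      supercomm emb (adag i) (a j) =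
        \sum_(l : {set 'I_n} | (l != set0) && (l \subset i :&: j))
          (-1) ^+ (1 + #|l| + inversions (symdiff i j) l)%N
            *: (adag (i :\: l) \o a (j :\: l))%VF
    & supercomm emb (a i) (adag j) =
        \sum_(l : {set 'I_n} | (l != set0) && (l \subset i :&: j))
          (-1) ^+ (1 + #|l| + inversions l (symdiff i j))%N
            *: (a (i :\: l) \o adag (j :\: l))%VF].
Proof.
move=> a adag i j; split.
- exact: (supercomm_annihilation v_basis v_orthonormal E_exterior dotE_induced lcontrP).
- exact: (supercomm_creation v_basis v_orthonormal E_exterior dotE_induced).
- exact: (supercomm_creation_annihilation v_basis v_orthonormal E_exterior dotE_induced lcontrP).
- exact: (supercomm_annihilation_creation v_basis v_orthonormal E_exterior dotE_induced lcontrP).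
Qed.
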